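(* Let $q$ be a prime power, $n\ge 2$ an integer, $a,b\in\mathbb{F}_q^{*}$, and $d:=\gcd(n,q-1)$. Let $P_n(a,b)$ be the number of irreducible polynomials in $\mathbb{F}_q[T]$ of the form $T^n-aT^{n-1}+\cdots+(-1)^n b$ (monic of degree $n$, with coefficient of $T^{n-1}$ equal to $-a$ and constant coefficient $(-1)^n b$). Then \[ \Big| P_n(a,b)-\frac{q^n-1}{nq(q-1)}\Big| \le \frac{1}{n}\left(\frac{1+(q-2)q^{(n-1)/2}-q^{(n-2)/2}(q^{1/2}-1)(d-1)}{q-1}+\frac{1}{q}\right)+\frac{q^{n/2}-1}{q(q-1)}+\frac{n}{2}\,q^{(n-4)/4}. \] *)

(* Defs.v *)
From HB Require Import structures.
From mathcomp Require Export all_boot all_order all_algebra.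
From mathcomp Require Export boolp reals exp.

Set Implicit Arguments.
Unset Strict Implicit.
Unset Printing Implicit Defensive.

Import Order.TTheory GRing.Theory Num.Theory.
Local Open Scope ring_scope.

(* {poly_n.+1 F} is the finite type of the polynomials of degree at most n. *)
Definition irr_trace_norm (F : finFieldType) (n : nat) (a b : F) :
    {set {poly_(n.+1) F}} :=
  [set p : {poly_(n.+1) F} |
    [&& size (p : {poly F}) == n.+1,
        (p : {poly F}) \is monic,
        (p : {poly F})`_n.-1 == - a,
        (p : {poly F})`_0 == (-1) ^+ n * b
      & `[< irreducible_poly (p : {poly F}) >] ] ].

Definition num_irr_trace_norm (F : finFieldType) (n : nat) (a b : F) : nat :=
  #|irr_trace_norm n a b|.

(* Main.v *)
(* Put [lam f = psi (c * tr f) * chi (nm f)] for additive and multiplicative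
   characters [psi] and [chi] of [F], where [tr] and [nm] are read off the
   coefficients of the monic polynomial [f].  This is completely
   multiplicative, and unless both characters are trivial its L-series
   [\sum_f lam f T ^ deg f] is the linear polynomial [1 + G T], with [G] a
   Gauss sum, because the trace and the norm of a monic polynomial of degree
   at least 2 vary independently.  The logarithmic derivative of the Euler
   product then gives [\sum_(deg (p ^ j) = n) deg p * lam (p ^ j) = - (- G) ^ n].
   Summing over all pairs of characters isolates the prime powers [p ^ j] of
   degree [n], trace [a] and norm [b]; the sum over [c] produces a second Gauss
   sum, and [|G| ^ 2 = q] bounds the deviation from [(q ^ n - 1) / (q (q - 1))].

   The terms with [j = 1] count the irreducible polynomials [n] times.  Those
   with [deg p >= 2] and [j >= 2] are at most [n q ^ (deg p - 2)] for each
   degree, which the last two terms of the bound absorb; a linear [p] adds at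
   most 1.  This 1 matters only for [n = 2], where the main term is already
   below the bound, and for [n = 3].  There it forces [a = 3 x], [b = x ^ 3],
   and irreducible members of the family [(T - x) ^ 3 + c T] are found by the
   pigeonhole principle: a root [t] determines [c], and only [q - 2] values of
   [t] compete for [q - 1] values of [c]. *)
Require Import Defs.
From mathcomp Require Import all_fingroup all_solvable all_field all_character.
From mathcomp Require Import ring lra zify.

Set Implicit Arguments.
Unset Strict Implicit.
Unset Printing Implicit Defensive.

Import Order.TTheory GRing.Theory Num.Theory.
Local Open Scope ring_scope.

(** * Trace and norm of monic polynomials *)

Section Monics.

Variable F : finFieldType.
Implicit Types (f g p : {poly F}) (k m n : nat).

(** A duplicate-free list, so that sums over monic polynomials can be reindexed through
    [perm_eq]. *)
Definition monics k : seq {poly F} :=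
  [seq 'X^k + (p : {poly F}) | p : {poly_k F}].

Lemma monicsE k f : (f \in monics k) = (f \is monic) && (size f == k.+1).
Proof.
apply/mapP/andP => [[p _ ->]|[mf /eqP sf]].
  have sp := size_npoly p.
  have sX : (size (p : {poly F}) < size ('X^k : {poly F}))%N by rewrite size_polyXn ltnS.
  by rewrite monicE lead_coefDl // lead_coefXn size_polyDl // size_polyXn.
have s : (size (f - 'X^k)%R <= k)%N.
  apply/leq_sizeP => j kj; rewrite coefB coefXn.
  have [->|jk] := eqVneq j k.
    by move: mf; rewrite monicE /lead_coef sf /= => /eqP->; rewrite subrr.
  by rewrite nth_default ?subrr // sf ltn_neqAle eq_sym jk.
exists (npolyp k (f - 'X^k)); first by rewrite mem_enum.
by rewrite npolypK // addrC subrK.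
Qed.

Lemma monicsP k f : reflect (f \is monic /\ size f = k.+1) (f \in monics k).
Proof. by rewrite monicsE; apply: (iffP andP) => -[? /eqP]. Qed.

Lemma monics_uniq k : uniq (monics k).
Proof.
rewrite map_inj_uniq ?enum_uniq // => p q /addrI pq.
exact/val_inj.
Qed.

Lemma size_monics k : size (monics k) = (#|F| ^ k)%N.
Proof. by rewrite size_map -cardE card_npoly. Qed.

Lemma monicsM k l f g : f \in monics k -> g \in monics l -> f * g \in monics (k + l).
Proof.
move=> /monicsP[mf sf] /monicsP[mg sg]; apply/monicsP; split; first by rewrite rpredM.
by rewrite size_monicM ?monic_neq0 // sf sg addnS /= addSn.
Qed.

Lemma monicsX k f j : f \in monics k -> f ^+ j \in monics (k * j).
Proof.
move=> fk; elim: j => [|j IH].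
  by rewrite muln0 expr0; apply/monicsP; rewrite monic1 size_poly1.
by rewrite exprS mulnS; apply: monicsM.
Qed.

(* For a monic [f] with roots [x_i] in a splitting field, [ptrace f] is the
   sum and [pnorm f] the product of the [x_i]; the factor ['X] makes the trace
   of the constant polynomial [1] vanish. *)
Definition ptrace f : F := - ('X * f)`_(size f).-1.
Definition pnorm f : F := (-1) ^+ (size f).-1 * f`_0.

Lemma ptraceM f g : f \is monic -> g \is monic ->
  ptrace (f * g) = ptrace f + ptrace g.
Proof.
move=> mf mg; rewrite /ptrace -opprD; congr (- _).
have sf : (0 < size f)%N by rewrite size_poly_gt0 monic_neq0.
have sg : (0 < size g)%N by rewrite size_poly_gt0 monic_neq0.
rewrite (size_monicM mf) ?monic_neq0 //.
have lf : f`_(size f).-1 = 1 by move: mf; rewrite monicE => /eqP.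
have lg : g`_(size g).-1 = 1 by move: mg; rewrite monicE => /eqP.
set a := (size f).-1 in lf *; set b := (size g).-1 in lg *.
have fa i : (a < i)%N -> f`_i = 0.
  by move=> ai; rewrite nth_default // -(prednK sf).
have gb i : (b < i)%N -> g`_i = 0.
  by move=> bi; rewrite nth_default // -(prednK sg).
have -> : ((size f + size g).-1).-1 = (a + b)%N.
  by rewrite -(prednK sf) -(prednK sg) addSn addnS.
rewrite !coefXM addn_eq0.
clearbody a b.
case: a lf fa => [|a] lf fa.
  case: b lg gb => [|b] lg gb /=; first by rewrite addr0.
  rewrite ?add0n coefM big_ord_recl /= lf mul1r subn0 add0r big1 ?addr0 // => i _.
  by rewrite fa ?mul0r.
case: b lg gb => [|b] lg gb /=.
  rewrite addr0 addn0 coefM big_ord_recr /= subnn lg mulr1 big1 ?add0r // => i _.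
  by rewrite gb ?mulr0 // subn_gt0.
rewrite ?addSn ?addnS /= coefM ?addSn.
(* With degrees [a.+1] and [b.+1], only the indices [a] and [a.+1] survive: before them the
   coefficient of [g] lies beyond its degree, after them that of [f] does. *)
rewrite -(big_mkord xpredT (fun i => f`_i * g`_((a + b).+1 - i))).
rewrite (@big_cat_nat _ _ _ a) //=; last lia.
rewrite big_nat big1 ?add0r; last first.
  move=> i /andP[_ ia]; rewrite gb ?mulr0 //; lia.
rewrite big_ltn; last lia.
rewrite big_ltn; last lia.
rewrite big_nat big1 ?addr0; last first.
  by move=> i /andP[ia _]; rewrite fa ?mul0r.
rewrite lf mul1r; have -> : ((a + b).+1 - a = b.+1)%N by lia.
have -> : ((a + b).+1 - a.+1 = b)%N by lia.
by rewrite lg mulr1.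
Qed.

Lemma pnormM f g : f \is monic -> g \is monic ->
  pnorm (f * g) = pnorm f * pnorm g.
Proof.
move=> mf mg; rewrite /pnorm (size_monicM mf) ?monic_neq0 //.
have sf : (0 < size f)%N by rewrite size_poly_gt0 monic_neq0.
have sg : (0 < size g)%N by rewrite size_poly_gt0 monic_neq0.
rewrite coef0M -(prednK sf) -(prednK sg) addSn addnS /= exprD; ring.
Qed.

Lemma ptrace1 : ptrace 1 = 0.
Proof. by rewrite /ptrace mulr1 size_poly1 coefX oppr0. Qed.

Lemma pnorm1 : pnorm 1 = 1.
Proof. by rewrite /pnorm size_poly1 coef1 mul1r. Qed.

Lemma ptraceX f j : f \is monic -> ptrace (f ^+ j) = j%:R * ptrace f.
Proof.
move=> mf; elim: j => [|j IH]; first by rewrite expr0 ptrace1 mul0r.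
by rewrite exprS ptraceM ?rpredX // IH mulrS mulrDl mul1r.
Qed.

Lemma pnormX f j : f \is monic -> pnorm (f ^+ j) = pnorm f ^+ j.
Proof.
move=> mf; elim: j => [|j IH]; first by rewrite !expr0 pnorm1.
by rewrite !exprS pnormM ?rpredX // IH.
Qed.

Lemma ptrace_monics k f : f \in monics k.+1 -> ptrace f = - f`_k.
Proof. by move=> /monicsP[_ sf]; rewrite /ptrace sf coefXM. Qed.

Lemma pnorm_monics k f : f \in monics k -> pnorm f = (-1) ^+ k * f`_0.
Proof. by move=> /monicsP[_ sf]; rewrite /pnorm sf. Qed.

End Monics.

(** * Factorization of monic polynomials *)

Section Factorization.

Variable F : finFieldType.
Implicit Types (f g p : {poly F}) (j k m n : nat).

Lemma monic_irreducible_divisor f : f \is monic -> (1 < size f)%N ->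
  exists p, [/\ p \is monic, irreducible_poly p & p %| f].
Proof.
have [s] := ubnP (size f); elim: s f => // s IH f; rewrite ltnS => fs mf f1.
have f0 : f != 0 by rewrite monic_neq0.
have [irrf|] := pselect (irreducible_poly f); first by exists f.
move=> /not_andP[//|] /existsNP[q] /not_implyP[q1] /not_implyP[qf /negP nq].
have q0 : q != 0 by apply: contraTneq qf => ->; rewrite dvd0p.
have lq : lead_coef q != 0 by rewrite lead_coef_eq0.
have sq : size ((lead_coef q)^-1 *: q) = size q by rewrite size_scale ?invr_eq0.
have [||| p [mp ip pq]] := IH ((lead_coef q)^-1 *: q).
- rewrite sq (leq_trans _ fs) // ltn_neqAle dvdp_leq // andbT.
  by apply: contra nq; rewrite dvdp_size_eqp.
- by rewrite monicE lead_coefZ mulVf.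
- by rewrite sq ltn_neqAle eq_sym q1 size_poly_gt0.
exists p; split=> //; rewrite (dvdp_trans _ qf) //.
by move: pq; rewrite dvdpZr ?invr_eq0.
Qed.

Definition irreds N : seq {poly F} :=
  [seq p <- [seq (p : {poly F}) | p : {poly_(N.+1) F}]
     | (p \is monic) && `[< irreducible_poly p >]].

Lemma irredsP N p :
  reflect [/\ p \is monic, irreducible_poly p & (size p <= N.+1)%N] (p \in irreds N).
Proof.
rewrite mem_filter -andbA; apply: (iffP and3P) => -[mp].
  by move=> /asboolP ip /mapP[q _ qE]; split=> //; rewrite qE; exact: (size_npoly q).
move=> ip sp; split=> //; first exact/asboolP.
by apply/mapP; exists (npolyp N.+1 p); rewrite ?mem_enum // npolypK.
Qed.

Lemma irreds_uniq N : uniq (irreds N).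
Proof. by rewrite filter_uniq // map_inj_uniq ?enum_uniq //; apply: val_inj. Qed.

Lemma irred_coprime p q : p \is monic -> q \is monic ->
  irreducible_poly p -> irreducible_poly q -> p != q -> coprimep p q.
Proof.
move=> mp mq ip iq pq; rewrite (irreducible_poly_coprime _ ip).
apply: contra pq => pdq; rewrite -eqp_monic //.
by apply: iq.2 => //; case: ip => sp _; rewrite neq_ltn sp orbT.
Qed.

(** The number of [j] with [p ^+ j %| f] is the multiplicity of [p] in [f], so this is unique
    factorization read through degrees. Splitting off an irreducible factor [p0] lowers its own
    multiplicity by one and, by coprimality, no other. *)
Lemma degree_as_divisor_sum N k f : (k <= N)%N -> f \in monics F k ->
  k = (\sum_(p <- irreds N) \sum_(1 <= j < N.+1) (size p).-1 * ((p ^+ j)%R %| f)%R)%N.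
Proof.
elim/ltn_ind: k f => k IH f kN fk.
have [mf sf] := monicsP _ _ fk.
have big_dvd p j g : p \is monic -> (1 < size p)%N -> g != 0 ->
    (size g <= j)%N -> (p ^+ j %| g) = false.
  move=> mp sp g0 gj; apply/negP => /dvdp_leq - /(_ g0).
  have /(monicsX j)/monicsP[_ ->] : p \in monics F (size p).-1.
    by apply/monicsP; rewrite prednK // ltnW.
  have : (j <= (size p).-1 * j)%N by rewrite leq_pmull // -ltnS prednK // ltnW.
  by move=> h1 h2; have := leq_trans (leq_ltn_trans h1 h2) gj; rewrite ltnn.
case: k => [|k] in IH kN fk sf *.
  rewrite big_seq big1 // => p /irredsP[mp [sp _] _].
  rewrite big_nat big1 // => j /andP[j1 _].
  by rewrite big_dvd ?muln0 ?monic_neq0 // sf.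
have [//||p0 [mp0 ip0 /dvdpP[g fE]]] := @monic_irreducible_divisor f; first by rewrite sf.
have mg : g \is monic by move: mf; rewrite fE monicMr.
have sp0 : (1 < size p0)%N by case: ip0.
have sE : (size g).-1 = (k.+1 - (size p0).-1)%N /\ (0 < size g)%N /\ (size p0 <= k.+2)%N.
  have : size f = (size g + size p0).-1 by rewrite fE size_monicM ?monic_neq0.
  have : (0 < size g)%N by rewrite size_poly_gt0 monic_neq0.
  rewrite sf; lia.
have gk : g \in monics F (k.+1 - (size p0).-1).
  by apply/monicsP; split=> //; case: sE => <- [s0 _]; rewrite prednK.
have p0N : p0 \in irreds N.
  by apply/irredsP; split=> //; case: sE => _ [_]; lia.
have -> : k.+1 = ((size p0).-1 + (k.+1 - (size p0).-1))%N by case: sE; lia.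
rewrite [X in (_ + X)%N](IH _ _ g) //; [|lia|lia].
rewrite (bigD1_seq p0) ?irreds_uniq //= [in RHS](bigD1_seq p0) ?irreds_uniq //=.
(* Exponents shift by one between [g] and [f = g * p0]; the exponent [N] contributes nothing for
   [g], whose degree is below [N]. *)
rewrite addnA; congr (_ + _)%N.
  rewrite [in LHS]big_nat_recr /=; last lia.
  rewrite big_dvd ?monic_neq0 ?muln0 ?addn0 //; last by case: (monicsP _ _ gk) => _ ->; lia.
  rewrite [in RHS]big_ltn; last lia.
  rewrite expr1 fE dvdp_mull // muln1; congr addn.
  rewrite [in RHS]big_add1 /=; apply: eq_bigr => j _.
  by rewrite exprSr dvdp_mul2r // monic_neq0.
rewrite big_seq_cond [RHS]big_seq_cond; apply: eq_bigr => p /andP[/irredsP[mp ip _] pp0].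
apply: eq_bigr => j _; rewrite fE Gauss_dvdpl //.
by rewrite coprimep_expl // irred_coprime.
Qed.

End Factorization.

(** * The logarithmic derivative of an L-series *)

Section LogDerivative.

Variables (F : finFieldType) (R : comNzRingType) (lam : {poly F} -> R).
Hypothesis lam1 : lam 1 = 1.
Hypothesis lamM : forall f g, f \is monic -> g \is monic ->
  lam (f * g) = lam f * lam g.
Implicit Types (f g h p : {poly F}) (j k m n : nat).

Definition Lcoef k : R := \sum_(f <- monics F k) lam f.

(* The coefficients of [T L'(T) / L(T)] for [L(T) = \sum_k Lcoef k T ^ k],
   restricted to prime powers [p ^+ j] with [deg p <= N] and [j <= N]. *)
Definition LogLcoef N k : R :=
  \sum_(p <- irreds F N) \sum_(1 <= j < N.+1 | ((size p).-1 * j == k)%N)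
     (size p).-1%:R * lam (p ^+ j).

Lemma Lcoef0 : Lcoef 0 = 1.
Proof.
have e : perm_eq (monics F 0) [:: 1].
  apply: uniq_perm => //; first exact: monics_uniq.
  move=> f; rewrite inE; apply/monicsP/eqP => [[mf sf]|->]; last first.
    by rewrite monic1 size_poly1.
  apply/eqP; rewrite -eqp_monic ?monic1 //; apply/andP; split; last exact: dvd1p.
  by rewrite dvdp1 sf.
by rewrite /Lcoef (perm_big _ e) big_seq1.
Qed.

Lemma sum_multiples h l k : h \in monics F l ->
  \sum_(f <- monics F k | h %| f) lam f = if (l <= k)%N then lam h * Lcoef (k - l) else 0.
Proof.
move=> hl; have [mh sh] := monicsP _ _ hl; case: leqP => lk; last first.
  rewrite big_seq_cond big1 // => f /andP[/monicsP[mf sf] /dvdp_leq].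
  by rewrite monic_neq0 // sf sh ltnS leqNgt lk => /(_ isT).
rewrite -big_filter.
have e : perm_eq [seq f <- monics F k | h %| f] [seq h * g | g <- monics F (k - l)].
  apply: uniq_perm; first by rewrite filter_uniq ?monics_uniq.
    rewrite map_inj_uniq ?monics_uniq // => f g.
    by apply: mulfI; rewrite monic_neq0.
  move=> f; rewrite mem_filter; apply/andP/mapP => [[/dvdpP[g ->] gk]|[g gk ->]].
    have [mgh sgh] := monicsP _ _ gk.
    have mg : g \is monic by move: mgh; rewrite monicMr.
    exists g; last by rewrite mulrC.
    apply/monicsP; split=> //.
    move: sgh; rewrite size_monicM ?monic_neq0 // sh addnS /=.
    by move=> e; apply/eqP; rewrite -(eqn_add2r l) e addSn subnK.
  by rewrite dvdp_mulr // -{1}(subnKC lk) monicsM.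
rewrite (perm_big _ e) big_map mulr_sumr big_seq [RHS]big_seq.
by apply: eq_bigr => g /monicsP[mg _]; rewrite lamM.
Qed.

(** This is the coefficient of [T ^ k] in [T L' = (T L' / L) * L]. The factor [k], the degree of
    each [f], is expanded over the prime powers dividing [f]; summing over [f] first leaves the
    multiples of one prime power. *)
Lemma log_derivative_recurrence N k : (k <= N)%N ->
  k%:R * Lcoef k = \sum_(1 <= i < k.+1) LogLcoef N i * Lcoef (k - i).
Proof.
move=> kN.
transitivity (\sum_(p <- irreds F N) \sum_(1 <= j < N.+1)
   if ((size p).-1 * j <= k)%N
   then (size p).-1%:R * lam (p ^+ j) * Lcoef (k - (size p).-1 * j) else 0).
  transitivity (\sum_(f <- monics F k) \sum_(p <- irreds F N) \sum_(1 <= j < N.+1)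
     (if p ^+ j %| f then (size p).-1%:R * lam f else 0)).
    rewrite mulr_sumr big_seq [RHS]big_seq; apply: eq_bigr => f fk.
    rewrite {1}(degree_as_divisor_sum kN fk) natr_sum mulr_suml.
    apply: eq_bigr => p _; rewrite natr_sum mulr_suml; apply: eq_bigr => j _.
    by case: ifP => _; rewrite ?muln1 ?muln0 ?mul0r.
  rewrite exchange_big /= big_seq [RHS]big_seq; apply: eq_bigr => p /irredsP[mp [sp _] _].
  rewrite exchange_big /=; apply: eq_bigr => j _.
  have pj : p ^+ j \in monics F ((size p).-1 * j).
    by apply: monicsX; apply/monicsP; rewrite prednK // ltnW.
  rewrite -big_mkcond /= -mulr_sumr (sum_multiples _ pj).
  by case: ifP; rewrite ?mulr0 ?mulrA.
under [RHS]eq_bigr do rewrite mulr_suml.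
rewrite [RHS]exchange_big /= big_seq [RHS]big_seq.
apply: eq_bigr => p /irredsP[mp [sp _] _].
under [RHS]eq_bigr do rewrite mulr_suml big_mkcond.
rewrite [RHS]exchange_big /= big_nat [RHS]big_nat; apply: eq_bigr => j /andP[j1 _].
rewrite -big_mkcond /=.
have x0 : (0 < (size p).-1 * j)%N by rewrite muln_gt0 j1 andbT -ltnS prednK // ltnW.
rewrite (eq_bigl (fun i => i == ((size p).-1 * j)%N)); last by move=> i; rewrite eq_sym.
by rewrite big_nat1_eq x0 ltnS.
Qed.

(** For [L = 1 + G T] the series [G T / (1 + G T)] is geometric; for [k >= 2] only the indices
    [k - 1] and [k] survive in the recurrence. *)
Lemma LogLcoef_of_linear_L N k : (forall i, (2 <= i)%N -> Lcoef i = 0) ->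
  (0 < k <= N)%N -> LogLcoef N k = - (- Lcoef 1) ^+ k.
Proof.
move=> L0; elim: k => // -[|k] IH /andP[_ kN].
  have := log_derivative_recurrence kN.
  by rewrite big_nat1 subnn Lcoef0 mulr1 mul1r expr1 opprK => <-.
have := log_derivative_recurrence kN.
rewrite L0 // mulr0 big_nat_recr // big_nat_recr //= subnn Lcoef0 mulr1.
rewrite IH ?(ltnW kN) // subSn // subnn big_nat big1 ?add0r; last first.
  by move=> i /andP[_ ik]; rewrite L0 ?mulr0 //; lia.
move=> /eqP; rewrite eq_sym addrC addr_eq0 => /eqP->.
by rewrite [in RHS]exprSr; ring.
Qed.

(** Here [L = (1 - T) / (1 - q T)], so the logarithmic derivative is a difference of two geometric
    series. *)
Lemma LogLcoef_of_trivial_L (q : R) N k :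
  (forall i, Lcoef i.+1 = q ^+ i.+1 - q ^+ i) ->
  (0 < k <= N)%N -> LogLcoef N k = q ^+ k - 1.
Proof.
move=> Lq; elim/ltn_ind: k => -[//|k] IH /andP[_ kN].
have := log_derivative_recurrence kN.
rewrite big_nat_recr //= subnn Lcoef0 mulr1 Lq.
have -> : \sum_(1 <= i < k.+1) LogLcoef N i * Lcoef (k.+1 - i) =
   k%:R * (q ^+ k.+1 - q ^+ k) - (q ^+ k - 1).
  (* Expanding [(q ^ i - 1) (q ^ (k + 1 - i) - q ^ (k - i))] gives a constant and a part that
     telescopes. *)
  transitivity (\sum_(1 <= i < k.+1)
    ((q ^+ k.+1 - q ^+ k) - (- q ^+ (k.+1 - i.+1) - (- q ^+ (k.+1 - i))))).
    rewrite big_nat [RHS]big_nat; apply: eq_bigr => i /andP[i1 ik].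
    rewrite IH //; last by rewrite i1 ltnW // (leq_trans _ kN).
    rewrite subSn // Lq subSS.
    have -> : q ^+ k.+1 = q ^+ i * q ^+ (k - i).+1 by rewrite -exprD addnS subnKC.
    have -> : q ^+ k = q ^+ i * q ^+ (k - i) by rewrite -exprD subnKC.
    by ring.
  rewrite sumrB telescope_sumr // sumr_const_nat subn1 /= subnn expr0 ?subn1 -mulr_natl.
  by ring.
move=> /eqP; rewrite addrC -subr_eq => /eqP <-.
by rewrite -natr1; ring.
Qed.

End LogDerivative.

(** * Gauss sums *)

(** The irreducible characters of an abelian group are linear and their kernels meet trivially, so
    one of them is nontrivial at [1]. *)
Lemma additive_character_exists (F : finFieldType) : exists psi : F -> algC,
  [/\ {morph psi : x y / x + y >-> x * y}, forall x, `|psi x| = 1 & exists x, psi x != 1].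
Proof.
pose G := [set: F]%G.
have lin : forall i : Iirr G, 'chi_i \is a linear_char.
  by apply/char_abelianP/centsP => x _ y _; apply: addrC.
have /existsP[i hi] : [exists i : Iirr G, 1 \notin cfker 'chi_i].
  rewrite -negb_forall; apply/negP => /forallP h.
  have : (1 : F) \in (\bigcap_i cfker 'chi[G]_i)%g by apply/bigcapP => i _; apply: h.
  by rewrite TI_cfker_irr inE FinRing.zmod1gE oner_eq0.
exists 'chi_i; split.
- by move=> x y; rewrite -lin_charM ?inE.
- by move=> x; rewrite normC_lin_char ?inE.
exists 1; apply: contra hi => /eqP h.
by rewrite cfkerEirr inE h lin_char1.
Qed.

(** A generator of the unit group is sent to a primitive root of unity of order [#|F| - 1], so the
    powers of this one [chi] are all the multiplicative characters. *)
Lemma multiplicative_character_exists (F : finFieldType) : exists chi : F -> algC,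
  [/\ chi 0 = 0, {morph chi : x y / x * y}, forall x, x != 0 -> `|chi x| = 1,
    forall x, chi x = 1 -> x = 1 & exists g, (#|F|.-1).-primitive_root (chi g)].
Proof.
have q1 : (0 < #|F|.-1)%N by rewrite -ltnS prednK ?finNzRing_gt1 // ltnW ?finNzRing_gt1.
have xq (x : F) : x != 0 -> x ^+ #|F|.-1 = 1.
  move=> x0; apply: (mulfI x0); rewrite mulr1 -exprS prednK ?expf_card //.
  by rewrite ltnW ?finNzRing_gt1.
have /hasP[g _ prg] : has (#|F|.-1).-primitive_root (enum (predC1 (0 : F))).
  apply: has_prim_root => //.
  - by apply/allP => x; rewrite mem_enum => x0; apply/unity_rootP/xq.
  - exact: enum_uniq.
  - by rewrite -cardE cardC1.
have [z prz] := C_prim_root_exists q1.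
(* A discrete logarithm to base [g]; the default value is reached only at [0]. *)
pose chi (x : F) := if [pick i : 'I_#|F|.-1 | x == g ^+ i] is Some i then z ^+ i else 0.
have chig i : chi (g ^+ i) = z ^+ i.
  rewrite /chi; case: pickP => [j|/(_ (Ordinal (ltn_pmod i q1)))] /=.
    by rewrite (eq_prim_root_expr prg) -(eq_prim_root_expr prz) => /eqP.
  by rewrite (prim_expr_mod prg) eqxx.
have g0 i : g ^+ i != 0.
  apply: expf_neq0; apply/eqP => g0; have := prim_expr_order prg.
  by rewrite g0 expr0n -[_ == _]negbK -lt0n q1 => /eqP; rewrite eq_sym oner_eq0.
have logP x : x != 0 -> exists i, x = g ^+ i.
  by move=> /xq /(prim_rootP prg)[i ->]; exists i.
have chi0 : chi 0 = 0.
  by rewrite /chi; case: pickP => // i /=; rewrite eq_sym (negPf (g0 i)).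
have z1 : `|z| = 1.
  by apply/eqP; rewrite -(pexpr_eq1 q1) // -normrX prim_expr_order // normr1.
exists chi; split=> //.
- move=> x y; have [->|/logP[i ->]] := eqVneq x 0; first by rewrite mul0r chi0 mul0r.
  have [->|/logP[j ->]] := eqVneq y 0; first by rewrite mulr0 chi0 mulr0.
  by rewrite -exprD !chig exprD.
- by move=> x /logP[i ->]; rewrite chig normrX z1 expr1n.
- move=> x; have [->|/logP[i ->]] := eqVneq x 0.
    by rewrite chi0 => /eqP; rewrite eq_sym oner_eq0.
  rewrite chig -(expr0 z) -(expr0 g) => /eqP.
  by rewrite (eq_prim_root_expr prz) -(eq_prim_root_expr prg) => /eqP.
by exists (g ^+ 1); rewrite chig.
Qed.

(** Used for character sums that a change of variable multiplies by a nontrivial character value. *)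
Lemma fixed_by_scalar_eq0 (R : idomainType) (c x : R) : c != 1 -> c * x = x -> x = 0.
Proof.
move=> c1 /eqP; rewrite -subr_eq0 -{2}[x]mul1r -mulrBl mulf_eq0 subr_eq0 (negPf c1).
by move/eqP.
Qed.

Section GaussSums.

Variable F : finFieldType.
Variables psi chi : F -> algC.
Hypothesis psiD : {morph psi : x y / x + y >-> x * y}.
Hypothesis psi_norm : forall x, `|psi x| = 1.
Hypothesis psi_nontrivial : exists x, psi x != 1.
Hypothesis chi0 : chi 0 = 0.
Hypothesis chiM : {morph chi : x y / x * y}.
Hypothesis chi_norm : forall x, x != 0 -> `|chi x| = 1.
Hypothesis chi_inj1 : forall x, chi x = 1 -> x = 1.
Hypothesis chi_prim : exists g, (#|F|.-1).-primitive_root (chi g).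

Let q : algC := #|F|%:R.

Lemma card_pred_gt0 : (0 < #|F|.-1)%N.
Proof. by rewrite -ltnS prednK ?finNzRing_gt1 // ltnW ?finNzRing_gt1. Qed.

Lemma psi0 : psi 0 = 1.
Proof.
have : psi 0 * psi 0 = psi 0 * 1 by rewrite -psiD addr0 mulr1.
by apply: mulfI; rewrite -normr_eq0 psi_norm oner_eq0.
Qed.

Lemma psiN x : psi (- x) = (psi x)^*.
Proof.
have x0 : psi x != 0 by rewrite -normr_eq0 psi_norm oner_eq0.
by apply: (mulfI x0); rewrite -psiD subrr psi0 -normCK psi_norm expr1n.
Qed.

Lemma psi_sum t : \sum_x psi (t * x) = if t == 0 then q else 0.
Proof.
have [->|t0] := eqVneq t 0.
  by under eq_bigr do rewrite mul0r psi0; rewrite sumr_const.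
have [y py] := psi_nontrivial.
apply: (fixed_by_scalar_eq0 py).
rewrite [RHS](reindex_inj (addrI (y / t))) mulr_sumr; apply: eq_bigr => x _.
by rewrite mulrDr psiD (mulrC t (y / t)) divfK.
Qed.

Lemma chi1 : chi 1 = 1.
Proof.
have : chi 1 * chi 1 = chi 1 * 1 by rewrite -chiM !mulr1.
by apply: mulfI; rewrite -normr_eq0 chi_norm ?oner_eq0.
Qed.

Lemma chi_neq0 x : x != 0 -> chi x != 0.
Proof. by move=> x0; rewrite -normr_eq0 chi_norm ?oner_eq0. Qed.

Lemma chiX x n : chi (x ^+ n) = chi x ^+ n.
Proof. by elim: n => [|n IH]; rewrite ?expr0 ?chi1 // !exprS chiM IH. Qed.

Lemma chi_order x e : x != 0 -> (#|F|.-1 %| e)%N -> chi x ^+ e = 1.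
Proof.
move=> x0 /dvdnP[m ->]; rewrite mulnC exprM -chiX.
suff -> : x ^+ #|F|.-1 = 1 by rewrite chi1 expr1n.
by apply: (mulfI x0); rewrite mulr1 -exprS prednK ?expf_card // ltnW ?finNzRing_gt1.
Qed.

Lemma sum_nonzero (f : F -> algC) : \sum_(x | x != 0) f x = \sum_x f x - f 0.
Proof. by rewrite [X in _ = X - _](bigD1 0) //= addrC addrK. Qed.

Lemma chi_expr0 e : (0 < e)%N -> chi 0 ^+ e = 0.
Proof. by move=> e0; rewrite chi0 expr0n eqn0Ngt e0. Qed.

Lemma chi_sum_nontrivial e : (0 < e)%N -> ~~ (#|F|.-1 %| e)%N -> \sum_x chi x ^+ e = 0.
Proof.
move=> e0 de; have [g prg] := chi_prim.
rewrite (prim_order_dvd prg) in de.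
have g0 : g != 0.
  apply/eqP => g0; have := prim_expr_order prg.
  by rewrite g0 chi_expr0 ?card_pred_gt0 // => /eqP; rewrite eq_sym oner_eq0.
apply: (fixed_by_scalar_eq0 de).
rewrite [RHS](reindex_inj (mulfI g0)) mulr_sumr; apply: eq_bigr => x _.
by rewrite chiM exprMn.
Qed.

(** The trivial character is the exponent [#|F| - 1] and not [0], so that every power in the sum
    vanishes at [0]. For other [y != 1] the sum is geometric. *)
Lemma chi_dual_sum y : \sum_(1 <= e < #|F|) chi y ^+ e = if y == 1 then q - 1 else 0.
Proof.
have q0 : (0 < #|F|)%N by rewrite ltnW ?finNzRing_gt1.
have [->|y1] := eqVneq y 1.
  under eq_bigr do rewrite chi1 expr1n.
  by rewrite sumr_const_nat natrB // -/q.
have [->|y0] := eqVneq y 0.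
  by rewrite big_nat big1 // => e /andP[e0 _]; rewrite chi_expr0.
rewrite big_add1 big_mkord; under eq_bigr do rewrite exprS.
rewrite -mulr_sumr; apply/eqP; rewrite mulf_eq0 (negPf (chi_neq0 y0)) /=.
have c1 : chi y - 1 != 0 by rewrite subr_eq0; apply: contra y1 => /eqP /chi_inj1 ->.
by rewrite -(mulrI_eq0 _ (lregP c1)) -subrX1 chi_order // subrr.
Qed.

Definition gauss t e : algC := \sum_x psi (t * x) * chi x ^+ e.

Lemma gauss_trivial t e : t != 0 -> (0 < e)%N -> (#|F|.-1 %| e)%N -> gauss t e = -1.
Proof.
move=> t0 e0 de; have := sum_nonzero (fun x => psi (t * x)).
rewrite psi_sum (negPf t0) mulr0 psi0 sub0r => <-.
rewrite /gauss (bigD1 0) //= chi_expr0 // mulr0 add0r.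
by apply: eq_bigr => x x0; rewrite chi_order // mulr1.
Qed.

Lemma gauss_scale c e : c != 0 -> gauss c e = (chi c ^+ e)^* * gauss 1 e.
Proof.
move=> c0; rewrite /gauss [X in _ = _ * X](reindex_inj (mulfI c0)) mulr_sumr.
apply: eq_bigr => x _; rewrite mul1r chiM exprMn.
have h : chi c ^+ e * (chi c ^+ e)^* = 1 by rewrite -normCK normrX chi_norm // !expr1n.
by rewrite -[LHS]mul1r -h; ring.
Qed.

Lemma gauss_norm t e : t != 0 -> (0 < e)%N -> ~~ (#|F|.-1 %| e)%N ->
  `|gauss t e| = sqrtC q.
Proof.
move=> t0 e0 de; apply/eqP.
rewrite -(eqrXn2 (n := 2)) ?sqrtC_ge0 ?ler0n ?normr_ge0 // sqrtCK normCK.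
(* Substituting [u * y] for the first variable cancels [chi y ^+ e] against its conjugate; the sum
   over [y] then singles out [u = 1]. *)
have -> : gauss t e * (gauss t e)^* =
  \sum_(y | y != 0) \sum_u psi (t * (u - 1) * y) * chi u ^+ e.
  rewrite {2}/gauss rmorph_sum mulr_sumr (bigD1 0) //= rmorphM rmorphXn chi0 /=.
  rewrite conjC0 expr0n eqn0Ngt e0 !mulr0 add0r; apply: eq_bigr => y y0.
  rewrite /gauss (reindex_inj (mulIf y0)) mulr_suml; apply: eq_bigr => u _.
  rewrite rmorphM /= -psiN chiM exprMn.
  have -> : t * (u - 1) * y = t * (u * y) + - (t * y) by ring.
  rewrite psiD.
  have h : chi y ^+ e * (chi y ^+ e)^* = 1 by rewrite -normCK normrX chi_norm // !expr1n.
  rewrite -[RHS]mulr1 -h; ring.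
rewrite exchange_big /=.
(* Leaving out [y = 0] costs [1] for each [u]; weighted by [chi u ^+ e], these corrections sum to
   zero. *)
under eq_bigr do rewrite -mulr_suml sum_nonzero mulr0 psi0 psi_sum mulrBl mul1r.
rewrite sumrB chi_sum_nontrivial // subr0 (bigD1 1) //= subrr mulr0 eqxx chi1 expr1n mulr1.
rewrite big1 ?addr0 // => u u1.
by rewrite mulf_eq0 (negPf t0) subr_eq0 (negPf u1) mul0r.
Qed.

End GaussSums.

(** * Characters of monic polynomials *)

Lemma monics_perm (F : finFieldType) k (h : {poly F} -> {poly F}) :
  {in monics F k, forall f, h f \in monics F k} -> {in monics F k &, injective h} ->
  perm_eq (monics F k) (map h (monics F k)).
Proof.
move=> hk hinj; have u : uniq (map h (monics F k)) by rewrite map_inj_in_uniq ?monics_uniq.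
have [|_ e] := uniq_min_size u (s2 := monics F k) _ (eq_leq (esym (size_map h _))).
  by move=> _ /mapP[f fk ->]; apply: hk.
exact: (uniq_perm (monics_uniq _ _) u (fun f => esym (e f))).
Qed.

Lemma monics1_perm (F : finFieldType) : perm_eq (monics F 1) [seq 'X - x%:P | x : F].
Proof.
have u : uniq [seq 'X - x%:P | x : F].
  rewrite map_inj_uniq ?enum_uniq // => x y /addrI/oppr_inj.
  exact: polyC_inj.
have sE : (size (monics F 1) <= size [seq ('X - x%:P)%R | x : F])%N.
  by rewrite size_monics size_map -cardE expn1.
have [|_ e] := uniq_min_size u _ sE.
  by move=> _ /mapP[x _ ->]; apply/monicsP; rewrite monicXsubC size_XsubC.
exact: (uniq_perm (monics_uniq _ _) u (fun f => esym (e f))).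
Qed.

Lemma monics_addl (F : finFieldType) k (f r : {poly F}) :
  f \in monics F k -> (size r <= k)%N -> f + r \in monics F k.
Proof.
move=> /monicsP[mf sf] rk; have sr : (size r < size f)%N by rewrite sf ltnS.
by apply/monicsP; rewrite monicE lead_coefDl // -monicE mf size_polyDl.
Qed.

(** With [m = m' * d], the [d - 1] numbers [i * m'] for [0 < i < d] qualify. For [m = #|F| - 1] they
    are exponents [e] for which [chi ^ (e n)] is trivial. *)
Lemma count_multiples_gcd m n : (0 < m)%N ->
  ((gcdn n m).-1 <= count (fun e => m %| e * n) (index_iota 1 m))%N.
Proof.
move=> m0; set d := gcdn n m; have d0 : (0 < d)%N by rewrite gcdn_gt0 m0 orbT.
have /dvdnP[m' mE] : (d %| m)%N by exact: dvdn_gcdr.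
have /dvdnP[n' nE] : (d %| n)%N by exact: dvdn_gcdl.
have m'0 : (0 < m')%N by move: m0; rewrite mE muln_gt0 => /andP[].
have u : uniq [seq (i * m')%N | i <- iota 1 d.-1].
  by rewrite map_inj_uniq ?iota_uniq // => i j /eqP; rewrite eqn_pmul2r // => /eqP.
rewrite -(size_iota 1 d.-1) -(size_map (fun i => i * m')%N) -size_filter.
apply: uniq_leq_size => // x /mapP[i]; rewrite mem_iota => /andP[i1 id] ->.
rewrite mem_filter mem_index_iota muln_gt0 i1 m'0 /=.
have -> : (i * m' * n = i * n' * m)%N.
  by rewrite [X in _ = (_ * X)%N]mE [X in (_ * X)%N = _]nE mulnACA.
by rewrite dvdn_mull // mE mulnC ltn_pmul2l //; move: id; rewrite add1n prednK.
Qed.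

(** The weight [deg p] of a prime power is the von Mangoldt weight that the logarithmic derivative
    produces. *)
Definition weighted_count (F : finFieldType) N (a b : F) : nat :=
  \sum_(p <- irreds F N) \sum_(1 <= j < N.+1 | ((size p).-1 * j == N)%N)
    (size p).-1 * ((ptrace (p ^+ j) == a) && (pnorm (p ^+ j) == b)).

Section CharacterSums.

Variable F : finFieldType.
Variables psi chi : F -> algC.
Hypothesis psiD : {morph psi : x y / x + y >-> x * y}.
Hypothesis psi_norm : forall x, `|psi x| = 1.
Hypothesis psi_nontrivial : exists x, psi x != 1.
Hypothesis chi0 : chi 0 = 0.
Hypothesis chiM : {morph chi : x y / x * y}.
Hypothesis chi_norm : forall x, x != 0 -> `|chi x| = 1.
Hypothesis chi_inj1 : forall x, chi x = 1 -> x = 1.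
Hypothesis chi_prim : exists g, (#|F|.-1).-primitive_root (chi g).

Let q : algC := #|F|%:R.

Definition lam c e (f : {poly F}) : algC := psi (c * ptrace f) * chi (pnorm f) ^+ e.

Lemma lam_1 c e : lam c e 1 = 1.
Proof. by rewrite /lam ptrace1 pnorm1 mulr0 (psi0 psiD) // (chi1 chiM) // mul1r expr1n. Qed.

Lemma lam_mul c e f g : f \is monic -> g \is monic ->
  lam c e (f * g) = lam c e f * lam c e g.
Proof.
by move=> mf mg; rewrite /lam ptraceM // pnormM // mulrDr psiD chiM exprMn mulrACA.
Qed.

Lemma Lcoef1 c e : Lcoef (lam c e) 1 = gauss psi chi c e.
Proof.
rewrite /Lcoef (perm_big _ (monics1_perm F)) big_map big_enum /=; apply: eq_bigr => x _.
have h : 'X - x%:P \in monics F 1 by apply/monicsP; rewrite monicXsubC size_XsubC.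
rewrite /lam (ptrace_monics h) (pnorm_monics h) expr1 coefB coefX coefC /=.
by rewrite sub0r mulN1r !opprK.
Qed.

Lemma Lcoef_additive c e k : c != 0 -> (2 <= k)%N -> Lcoef (lam c e) k = 0.
Proof.
case: k => [//|[//|k]] c0 _.
have [y py] := psi_nontrivial.
(* Adds [y / c] to the trace and, the degree being at least 2, keeps the norm; [lam] is multiplied
   by [psi y]. *)
pose h (f : {poly F}) := f + (- (y / c)) *: 'X^(k.+1).
have hk f : f \in monics F k.+2 -> h f \in monics F k.+2.
  move=> fk; apply: monics_addl => //.
  by rewrite (leq_trans (size_scale_leq _ _)) ?size_polyXn.
have /(_ hk) hp := @monics_perm F k.+2 h.
apply: (fixed_by_scalar_eq0 py); rewrite /Lcoef.
rewrite [RHS](perm_big _ (hp _)); last by move=> f g _ _ /addIr.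
rewrite [RHS]big_map mulr_sumr big_seq [RHS]big_seq; apply: eq_bigr => f fk.
rewrite /lam (ptrace_monics fk) (ptrace_monics (hk f fk)).
rewrite (pnorm_monics fk) (pnorm_monics (hk f fk)).
rewrite /h !coefD !coefZ !coefXn eqxx /= mulr0 addr0 mulr1 mulrA -psiD.
by congr (psi _ * _); field.
Qed.

Lemma Lcoef_multiplicative e k : (0 < e)%N -> ~~ (#|F|.-1 %| e)%N -> (0 < k)%N ->
  Lcoef (lam 0 e) k = 0.
Proof.
case: k => // k e0 de _; have [g prg] := chi_prim.
rewrite (prim_order_dvd prg) in de.
have g0 : g != 0.
  apply/eqP => g0; have := prim_expr_order prg.
  by rewrite g0 (chi_expr0 chi0) ?card_pred_gt0 // => /eqP; rewrite eq_sym oner_eq0.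
(* Multiplies the norm by [g]. In degree 1 this also moves the trace, which [lam 0 e] does not
   see. *)
pose h (f : {poly F}) := f + ((g - 1) * f`_0)%:P.
have hk f : f \in monics F k.+1 -> h f \in monics F k.+1.
  by move=> fk; apply: monics_addl => //; rewrite (leq_trans (size_polyC_leq1 _)).
have h0 f : (h f)`_0 = g * f`_0 by rewrite coefD coefC eqxx mulrBl mul1r addrC subrK.
have hinj : injective h.
  move=> f1 f2 e12; have := congr1 (fun p : {poly F} => p`_0) e12.
  by rewrite !h0 => /(mulfI g0) e'; move: e12; rewrite /h e' => /addIr.
apply: (fixed_by_scalar_eq0 de); rewrite /Lcoef.
rewrite [RHS](perm_big _ (monics_perm hk (in2W hinj))).
rewrite [RHS]big_map mulr_sumr big_seq [RHS]big_seq; apply: eq_bigr => f fk.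
rewrite /lam (pnorm_monics fk) (pnorm_monics (hk f fk)) h0 !mul0r (psi0 psiD) // !mul1r.
by rewrite [X in _ = chi X ^+ _]mulrCA [in RHS]chiM exprMn.
Qed.

(** The principal character is [1] on monic polynomials prime to ['X] and [0] on the [q ^ k]
    multiples of ['X]. *)
Lemma Lcoef_trivial e k : (0 < e)%N -> (#|F|.-1 %| e)%N ->
  Lcoef (lam 0 e) k.+1 = q ^+ k.+1 - q ^+ k.
Proof.
move=> e0 de.
transitivity (\sum_(f <- monics F k.+1) (1 - (if 'X %| f then 1 else 0)) : algC).
  rewrite /Lcoef big_seq [RHS]big_seq; apply: eq_bigr => f fk.
  rewrite /lam mul0r (psi0 psiD) // mul1r (pnorm_monics fk).
  have -> : ('X %| f) = (f`_0 == 0).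
    by rewrite -['X]subr0 -polyC0 dvdp_XsubCl /root horner_coef0.
  case: eqP => [->|/eqP f0]; first by rewrite mulr0 subrr chi_expr0.
  by rewrite subr0 chi_order // mulf_neq0 // expf_neq0 // oppr_eq0 oner_eq0.
rewrite sumrB -big_mkcond /=.
have X1 : 'X \in monics F 1 by apply/monicsP; rewrite monicX size_polyX.
rewrite (@sum_multiples F algC (fun=> 1) _ _ _ k.+1 X1); last first.
  by move=> f g _ _; rewrite mulr1.
rewrite ltnS leq0n subn1 /= mul1r /Lcoef.
rewrite !big_const_seq !count_predT !size_monics !iter_addr_0.
by rewrite !natrX.
Qed.

Lemma LogLcoef_additive c e n : c != 0 -> (0 < n)%N ->
  LogLcoef (lam c e) n n = - (- gauss psi chi c e) ^+ n.
Proof.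
move=> c0 n0; rewrite (LogLcoef_of_linear_L (lam_1 c e) (@lam_mul c e)) ?n0 ?leqnn //.
  by rewrite Lcoef1.
by move=> i; apply: Lcoef_additive.
Qed.

Lemma LogLcoef_multiplicative e n : (0 < e)%N -> ~~ (#|F|.-1 %| e)%N -> (0 < n)%N ->
  LogLcoef (lam 0 e) n n = 0.
Proof.
move=> e0 de n0; rewrite (LogLcoef_of_linear_L (lam_1 0 e) (@lam_mul 0 e)) ?n0 ?leqnn //.
  by rewrite Lcoef_multiplicative // oppr0 expr0n -[_ == _]negbK -lt0n n0 oppr0.
by move=> i i2; apply: Lcoef_multiplicative => //; apply: ltnW.
Qed.

Lemma LogLcoef_trivial e n : (0 < e)%N -> (#|F|.-1 %| e)%N -> (0 < n)%N ->
  LogLcoef (lam 0 e) n n = q ^+ n - 1.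
Proof.
move=> e0 de n0.
rewrite (LogLcoef_of_trivial_L (q := q) (lam_1 0 e) (@lam_mul 0 e)) ?n0 ?leqnn //.
by move=> i; apply: Lcoef_trivial.
Qed.

(** The double sum factors into an additive sum at [x - a] and a multiplicative one at [y / b]. *)
Lemma character_orthogonality a b x y : b != 0 ->
  \sum_c \sum_(1 <= e < #|F|) (psi (c * a) * chi b ^+ e)^* * (psi (c * x) * chi y ^+ e) =
  q * (q - 1) * ((x == a) && (y == b))%:R.
Proof.
move=> b0.
transitivity ((\sum_c psi ((x - a) * c)) * \sum_(1 <= e < #|F|) chi (y / b) ^+ e).
  rewrite mulr_suml; apply: eq_bigr => c _; rewrite mulr_sumr; apply: eq_bigr => e _.
  have -> : (x - a) * c = c * x + - (c * a) by ring.
  rewrite psiD (psiN psiD) // chiM exprMn rmorphM /=.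
  have -> : chi b^-1 ^+ e = (chi b ^+ e)^*.
    apply: (mulfI (expf_neq0 e (chi_neq0 chi_norm b0))).
    rewrite -exprMn -chiM mulfV // (chi1 chiM) // expr1n.
    by rewrite -normCK normrX chi_norm // !expr1n.
  by ring.
rewrite (psi_sum psiD) // (chi_dual_sum chi0) //.
have -> : (y / b == 1) = (y == b) by rewrite -(inj_eq (mulIf b0)) divfK // mul1r.
rewrite subr_eq0.
by do 2 case: eqP => _; rewrite ?mulr0 ?mul0r ?mulr1.
Qed.

Lemma weighted_count_as_character_sum n a b : b != 0 ->
  q * (q - 1) * (weighted_count n a b)%:R =
  \sum_c \sum_(1 <= e < #|F|) (psi (c * a) * chi b ^+ e)^* * LogLcoef (lam c e) n n.
Proof.
move=> b0; rewrite /weighted_count /LogLcoef natr_sum mulr_sumr.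
under [RHS]eq_bigr => c _ do
  (under eq_bigr => e _ do rewrite mulr_sumr; rewrite exchange_big /=).
rewrite [RHS]exchange_big /=; apply: eq_bigr => p _.
under [RHS]eq_bigr => c _ do
  (under eq_bigr => e _ do rewrite mulr_sumr; rewrite exchange_big /=).
rewrite [RHS]exchange_big /= natr_sum mulr_sumr; apply: eq_bigr => j _.
rewrite natrM mulrCA -character_orthogonality // mulr_sumr; apply: eq_bigr => c _.
by rewrite mulr_sumr; apply: eq_bigr => e _; rewrite /lam mulrCA.
Qed.

(** By [gauss_scale], the [n]-th power of the Gauss sum at [c] depends on [c] only through the
    conjugate of [chi c ^+ (e * n)]; hence the sum over [c] contains the conjugate of a second Gauss
    sum. *)
Lemma nonprincipal_norm n a b e : (0 < n)%N -> b != 0 -> (0 < e)%N ->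
  `|\sum_(c | c != 0) (psi (c * a) * chi b ^+ e)^* * LogLcoef (lam c e) n n| =
  `|gauss psi chi a (e * n)| * `|gauss psi chi 1 e| ^+ n.
Proof.
move=> n0 b0 e0; have en0 : (0 < e * n)%N by rewrite muln_gt0 e0.
have -> : \sum_(c | c != 0) (psi (c * a) * chi b ^+ e)^* * LogLcoef (lam c e) n n =
   (gauss psi chi a (e * n))^* * ((chi b ^+ e)^* * (- (- gauss psi chi 1 e) ^+ n)).
  rewrite {1}/gauss rmorph_sum mulr_suml [RHS](bigD1 0) //=.
  rewrite (chi_expr0 chi0) // mulr0 conjC0 mul0r add0r; apply: eq_bigr => c c0.
  rewrite LogLcoef_additive // gauss_scale // !rmorphM !rmorphXn /= (mulrC c a).
  rewrite -[X in - X ^+ n]mulrN exprMn exprM; ring.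
by rewrite !normrM norm_conjC norm_conjC normrX chi_norm // expr1n mul1r normrN normrX
  normrN.
Qed.

Lemma weighted_count_deviation n a b : (0 < n)%N -> b != 0 ->
  `|q * (q - 1) * (weighted_count n a b)%:R - (q ^+ n - 1)| <=
  \sum_(1 <= e < #|F|) `|gauss psi chi a (e * n)| * `|gauss psi chi 1 e| ^+ n.
Proof.
move=> n0 b0; rewrite weighted_count_as_character_sum //.
rewrite (bigD1 0) //=.
(* For [c = 0] only the principal character, the last exponent, contributes: the main term. *)
have -> : \sum_(1 <= e < #|F|) (psi (0 * a) * chi b ^+ e)^* *
    LogLcoef (lam 0 e) n n = q ^+ n - 1.
  have q1 := card_pred_gt0 F.
  rewrite -[X in index_iota _ X](prednK (ltnW (finNzRing_gt1 F))).
  rewrite big_nat_recr // big_nat big1 /= ?add0r.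
    rewrite LogLcoef_trivial // mul0r (psi0 psiD) // mul1r.
    by rewrite (chi_order chiM) // rmorph1 mul1r.
  move=> e /andP[e1 eq1]; rewrite LogLcoef_multiplicative ?mulr0 //.
  by rewrite gtnNdvd.
rewrite addrAC subrr add0r exchange_big /=.
apply: (le_trans (ler_norm_sum _ _ _)).
rewrite [leLHS]big_nat [leRHS]big_nat; apply: ler_sum => e /andP[e0 _].
by rewrite nonprincipal_norm.
Qed.

End CharacterSums.

(** With [s = sqrtC q], the exponent [e = q - 1] contributes [1], any other [e] with [q - 1]
    dividing [e * n] contributes [s ^ n], and the rest [s ^ (n + 1)] each. *)
Lemma weighted_count_bound (F : finFieldType) n (a b : F) :
  (0 < n)%N -> a != 0 -> b != 0 ->
  `|#|F|%:R * (#|F|%:R - 1) * (weighted_count n a b)%:R - (#|F|%:R ^+ n - 1) : algC| <=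
  1 + sqrtC #|F|%:R ^+ n *
    ((gcdn n #|F|.-1).-1%:R + (#|F|.-1 - gcdn n #|F|.-1)%:R * sqrtC #|F|%:R).
Proof.
move=> n0 a0 b0; set q := #|F|%:R; set d := gcdn n _.
have [psi [psiD psi_norm psi_nt]] := additive_character_exists F.
have [chi [chi0 chiM chi_norm chi_inj1 chi_prim]] := multiplicative_character_exists F.
apply: le_trans (weighted_count_deviation psiD psi_norm psi_nt chi0 chiM
  chi_norm chi_inj1 chi_prim a n0 b0) _.
have q1 := card_pred_gt0 F.
rewrite -[X in index_iota _ X](prednK (ltnW (finNzRing_gt1 F))).
rewrite big_nat_recr //= addrC.
have -> : `|gauss psi chi a (#|F|.-1 * n)| * `|gauss psi chi 1 #|F|.-1| ^+ n = 1.
  rewrite !(gauss_trivial psiD psi_norm psi_nt chi0 chiM chi_norm)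
    ?oner_eq0 ?muln_gt0 ?q1 //.
    by rewrite normrN normr1 expr1n mulr1.
  by rewrite dvdn_mulr.
rewrite lerD2l; set s := sqrtC q.
have s0 : 0 <= s by rewrite sqrtC_ge0 ler0n.
have s1 : 1 <= s.
  rewrite -(@ler_pXn2r _ 2) ?nnegrE ?ler01 //.
  by rewrite expr1n sqrtCK ler1n ltnW // finNzRing_gt1.
pose P e := (#|F|.-1 %| e * n)%N.
have -> : \sum_(1 <= e < #|F|.-1) `|gauss psi chi a (e * n)| * `|gauss psi chi 1 e| ^+ n =
  \sum_(1 <= e < #|F|.-1) s ^+ n * (s - (P e)%:R * (s - 1)).
  rewrite big_nat [RHS]big_nat; apply: eq_bigr => e /andP[e0 eq1].
  rewrite (gauss_norm psiD psi_norm psi_nt chi0 chiM chi_norm chi_prim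
    (oner_neq0 _) e0) ?gtnNdvd //.
  rewrite mulrC; congr (_ * _); rewrite /P; case: (boolP (#|F|.-1 %| e * n)%N) => de.
    rewrite (gauss_trivial psiD psi_norm psi_nt chi0 chiM chi_norm) ?muln_gt0 ?e0 //.
    by rewrite normrN normr1 mul1r opprB addrC subrK.
  rewrite (gauss_norm psiD psi_norm psi_nt chi0 chiM chi_norm chi_prim) ?muln_gt0 ?e0 //.
  by rewrite mul0r subr0.
rewrite -mulr_sumr ler_wpM2l ?exprn_ge0 // sumrB sumr_const_nat -mulr_suml.
have -> : \sum_(1 <= e < #|F|.-1) (P e)%:R = (count P (index_iota 1 #|F|.-1))%:R :> algC.
  by rewrite -sum1_count natr_sum [RHS]big_mkcond; apply: eq_bigr => e _; case: (P e).
have d1 : (0 < d)%N by rewrite gcdn_gt0 q1 orbT.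
have dq : (d <= #|F|.-1)%N by rewrite dvdn_leq // dvdn_gcdr.
rewrite -(mulr_natl s) -(subn1 d) !natrB //.
(* As [s >= 1], bounding the number of smaller terms from below bounds the sum from above. *)
have cnt : d%:R - 1 <= (count P (index_iota 1 #|F|.-1))%:R :> algC.
  by rewrite -(natrB _ d1) ler_nat subn1 count_multiples_gcd.
have : (d%:R - 1) * (s - 1) <= (count P (index_iota 1 #|F|.-1))%:R * (s - 1).
  by rewrite ler_wpM2r // subr_ge0.
move=> h; rewrite -subr_ge0; rewrite -subr_ge0 in h.
by apply: etrans h; congr (0 <= _); ring.
Qed.

(** * Counting prime powers *)

(** For [m > A] both inequalities say [(m - A) ^ 2 <= B ^ 2 Q] in the natural numbers. This carries
    the bound from [algC], where characters take their values, to [R]. *)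
Lemma sqrt_bound_transfer (R : rcfType) (m A B Q : nat) :
  m%:R <= A%:R + B%:R * sqrtC Q%:R :> algC ->
  m%:R <= A%:R + B%:R * Num.sqrt Q%:R :> R.
Proof.
move=> h; have [mA|/ltnW Am] := leqP m A.
  by rewrite (le_trans (y := A%:R)) ?ler_nat // lerDl mulr_ge0 ?sqrtr_ge0 ?ler0n.
move: h; rewrite -lerBlDl -natrB // -lerBlDl -natrB //.
rewrite -(@ler_pXn2r _ 2) ?nnegrE ?mulr_ge0 ?sqrtC_ge0 ?ler0n // exprMn sqrtCK.
rewrite -!natrX -natrM ler_nat => h.
rewrite -(@ler_pXn2r _ 2) ?nnegrE ?mulr_ge0 ?sqrtr_ge0 ?ler0n // exprMn sqr_sqrtr ?ler0n //.
by rewrite -!natrX -natrM ler_nat.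
Qed.

Lemma weighted_count_bound_real (R : rcfType) (F : finFieldType) n (a b : F) :
  (0 < n)%N -> a != 0 -> b != 0 ->
  `|#|F|%:R * (#|F|%:R - 1) * (weighted_count n a b)%:R - (#|F|%:R ^+ n - 1) : R| <=
  1 + Num.sqrt #|F|%:R ^+ n *
    ((gcdn n #|F|.-1).-1%:R + (#|F|.-1 - gcdn n #|F|.-1)%:R * Num.sqrt #|F|%:R).
Proof.
move=> n0 a0 b0; have := weighted_count_bound n0 a0 b0.
set W := weighted_count n a b; set Q := #|F|; set u := (gcdn _ _).-1; set v := (_ - _)%N.
pose Z : int := Q%:Z * (Q%:Z - 1) * W%:Z - (Q%:Z ^+ n - 1).
have E (K : numDomainType) : `|Q%:R * (Q%:R - 1) * W%:R - (Q%:R ^+ n - 1) : K| = `|Z|%N%:R.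
  by rewrite natr_absz intr_norm /Z !(rmorphB, rmorphM, rmorphXn, rmorph1) /=.
rewrite !E.
(* The parity of [n] decides which of [s ^ n] and [s ^ (n + 1)] is a power of [Q]; either way the
   bound becomes [A + B s] with natural [A] and [B]. *)
pose k := n./2.
have nE : n = (odd n + k.*2)%N by rewrite odd_double_half.
case: (odd n) nE => ->; rewrite ?add0n ?add1n.
- have X (K : comNzRingType) (s : K) : s ^+ 2 = Q%:R ->
    1 + s ^+ k.*2.+1 * (u%:R + v%:R * s) = (1 + Q ^ k.+1 * v)%:R + (Q ^ k * u)%:R * s.
    move=> sQ; rewrite exprS -mul2n exprM sQ natrD !natrM !natrX exprS.
    by rewrite -{2}sQ; ring.
  rewrite !X ?sqrtCK ?sqr_sqrtr ?ler0n //; exact: sqrt_bound_transfer.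
have X (K : comNzRingType) (s : K) : s ^+ 2 = Q%:R ->
    1 + s ^+ k.*2 * (u%:R + v%:R * s) = (1 + Q ^ k * u)%:R + (Q ^ k * v)%:R * s.
  by move=> sQ; rewrite -mul2n exprM sQ natrD !natrM !natrX; ring.
rewrite !X ?sqrtCK ?sqr_sqrtr ?ler0n //; exact: sqrt_bound_transfer.
Qed.

Section PrimePowerCounts.

Variable F : finFieldType.
Implicit Types (a b x : F) (j k m n : nat).

Definition power_count n j a b : nat :=
  \sum_(p <- irreds F n | ((size p).-1 * j == n)%N)
    (size p).-1 * ((ptrace (p ^+ j) == a) && (pnorm (p ^+ j) == b)).

Lemma power_count1 n a b : (0 < n)%N ->
  power_count n 1 a b = (n * num_irr_trace_norm n a b)%N.
Proof.
case: n => // n _; rewrite /power_count /irreds big_filter_cond big_map big_enum_cond /=.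
rewrite /num_irr_trace_norm -sum1_card big_distrr /= [RHS]big_mkcond [LHS]big_mkcond /=.
apply: eq_bigr => p _; rewrite inE muln1 expr1 muln1.
have [mp|] := boolP ((p : {poly F}) \is monic); last by rewrite andbF.
have sp0 : (0 < size (p : {poly F}))%N by rewrite size_poly_gt0 monic_neq0.
have -> : (size (p : {poly F}) == n.+2) = ((size (p : {poly F})).-1 == n.+1).
  by rewrite -{1}(prednK sp0) eqSS.
case: eqP => [sp|]; last by rewrite andbF.
have pn : (p : {poly F}) \in monics F n.+1.
  by apply/monicsP; rewrite -(prednK sp0) sp.
case: asboolP => _; rewrite ?andbF //= sp.
rewrite (ptrace_monics pn) (pnorm_monics pn) eqr_oppLR andbT.
have -> : ((-1) ^+ n.+1 * (p : {poly F})`_0 == b) = ((p : {poly F})`_0 == (-1) ^+ n.+1 * b).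
  apply/eqP/eqP => [<-|->]; by rewrite mulrA -exprMn mulrNN mulr1 expr1n mul1r.
by case: ifP; rewrite ?muln1 ?muln0.
Qed.

Lemma weighted_count_split n a b : (0 < n)%N ->
  weighted_count n a b =
  (n * num_irr_trace_norm n a b + \sum_(2 <= j < n.+1) power_count n j a b)%N.
Proof.
move=> n0; rewrite -power_count1 // /weighted_count.
under eq_bigr do rewrite big_mkcond.
rewrite exchange_big /= big_ltn //; congr addn.
  by rewrite /power_count [RHS]big_mkcond.
by apply: eq_bigr => j _; rewrite /power_count [RHS]big_mkcond.
Qed.

(** Since [j * ptrace p = a] is nonzero, [j] is invertible in [F] and the trace is determined. The
    norm is one of at most [j] roots of [y ^ j = b], and [k] coefficients remain free. *)
Lemma count_power_trace_norm k j a b : a != 0 -> (0 < j)%N ->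
  (count (fun p => (ptrace (p ^+ j) == a) && (pnorm (p ^+ j) == b)) (monics F k.+2)
   <= j * #|F| ^ k)%N.
Proof.
move=> a0 j0.
pose rs := [seq y <- enum F | y ^+ j == b].
have rsj : (size rs <= j)%N.
  have sP : size ('X^j - b%:P) = j.+1 by rewrite size_XnsubC.
  rewrite -ltnS -sP; apply: max_poly_roots (filter_uniq _ (enum_uniq _)).
    by rewrite -size_poly_gt0 sP.
  by apply/allP => y; rewrite mem_filter rootE !hornerE subr_eq0 => /andP[].
pose phi (p : {poly F}) := (pnorm p, [ffun i : 'I_k => p`_i.+1]).
pose L := [seq p <- monics F k.+2 | (ptrace (p ^+ j) == a) && (pnorm (p ^+ j) == b)].
rewrite -size_filter -/L -(size_map phi).
have LP p : p \in L -> [/\ p \in monics F k.+2, j%:R * ptrace p = a & pnorm p ^+ j = b].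
  rewrite mem_filter => /andP[/andP[/eqP <- /eqP <-] pk]; have [mp _] := monicsP _ _ pk.
  by rewrite ptraceX // pnormX.
have -> : (j * #|F| ^ k = j * size (enum {ffun 'I_k -> F}))%N.
  by rewrite -cardE card_ffun card_ord.
apply: (@leq_trans (size rs * size (enum {ffun 'I_k -> F}))); last first.
  by rewrite leq_mul2r rsj orbT.
rewrite -(size_allpairs pair); apply: uniq_leq_size.
  rewrite map_inj_in_uniq ?filter_uniq ?monics_uniq //.
  move=> f g /LP[fk tf _] /LP[gk tg _] [e0 ei].
  have tfg : ptrace f = ptrace g.
    have j1 : (j%:R : F) != 0 by apply: contraNneq a0 => j1; rewrite -tf j1 mul0r.
    by apply: (mulfI j1); rewrite tf tg.
  rewrite (ptrace_monics fk) (ptrace_monics gk) in tfg; move/oppr_inj: tfg => tfg.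
  rewrite (pnorm_monics fk) (pnorm_monics gk) in e0.
  have s1 : (-1) ^+ k.+2 != 0 :> F by rewrite expf_neq0 // oppr_eq0 oner_eq0.
  move/(mulfI s1) in e0.
  have [mf sf] := monicsP _ _ fk; have [mg sg] := monicsP _ _ gk.
  apply/polyP => -[//|i].
  have [ik|ki] := ltnP i k.
    by have := congr1 (fun h : {ffun 'I_k -> F} => h (Ordinal ik)) ei; rewrite !ffunE.
  have [->//|ik] := eqVneq i k.
  have [->|ik1] := eqVneq i k.+1.
    by move: mf mg; rewrite !monicE /lead_coef sf sg /= => /eqP-> /eqP->.
  by rewrite !nth_default ?sf ?sg //; lia.
move=> _ /mapP[p /LP[pk _ np] ->]; apply/allpairsP; exists (phi p); split=> //.
- by rewrite mem_filter np eqxx mem_enum.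
- by rewrite mem_enum.
Qed.

Lemma power_count_leq_monics n j m a b : (0 < j)%N -> (m * j = n)%N ->
  (power_count n j a b <=
   m * count (fun p => (ptrace (p ^+ j) == a) && (pnorm (p ^+ j) == b)) (monics F m))%N.
Proof.
move=> j0 mn; set P := fun p : {poly F} => _.
have -> : power_count n j a b =
   (m * size [seq p <- irreds F n | P p && ((size p).-1 * j == n)%N])%N.
  rewrite size_filter -sum1_count big_distrr /= /power_count.
  rewrite big_mkcond [RHS]big_mkcond; apply: eq_bigr => p _; rewrite -/(P p) muln1.
  case: eqP => [pn|_]; rewrite ?andbF // andbT.
  have -> : (size p).-1 = m by apply/eqP; rewrite -(eqn_pmul2r j0) pn mn.
  by case: (P p); rewrite ?muln1 ?muln0.
rewrite leq_mul2l -size_filter; apply/orP; right.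
apply: uniq_leq_size (filter_uniq _ (irreds_uniq _ _)) _ => p.
rewrite mem_filter => /andP[/andP[Pp pn] /irredsP[mp [sp _] _]].
rewrite mem_filter Pp /=.
apply/monicsP; split=> //; move: pn; rewrite -mn eqn_pmul2r // => /eqP <-.
by rewrite prednK // ltnW.
Qed.

Lemma power_count_leq n j m a b : a != 0 -> (0 < j)%N ->
  (m.+2 * j = n)%N -> (power_count n j a b <= n * #|F| ^ m)%N.
Proof.
move=> a0 j0 mn; apply: leq_trans (power_count_leq_monics _ _ j0 mn) _.
by rewrite -mn -mulnA leq_mul2l count_power_trace_norm ?orbT.
Qed.

Lemma power_count_ndvd n j a b : ~~ (j %| n)%N -> power_count n j a b = 0%N.
Proof.
move=> jn; rewrite /power_count big1 // => p /eqP pn.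
by case/negP: jn; rewrite -pn dvdn_mull.
Qed.

(** For [j = n] the prime is linear, hence determined by its trace, and [a != 0] makes [n]
    invertible in [F]. *)
Lemma power_count_diag_le1 n a b : (0 < n)%N -> a != 0 -> (power_count n n a b <= 1)%N.
Proof.
move=> n0 a0; apply: leq_trans (power_count_leq_monics _ _ n0 (mul1n n)) _.
rewrite mul1n -size_filter; set L := filter _ _.
have LP p : p \in L -> p \in monics F 1 /\ n%:R * ptrace p = a.
  rewrite mem_filter => /andP[/andP[/eqP <- _] pk]; have [mp _] := monicsP _ _ pk.
  by rewrite ptraceX.
have uL : uniq L by rewrite filter_uniq ?monics_uniq.
case EL : L => [//|f [//|g L']]; exfalso.
move: (uL); rewrite EL /= inE negb_or => /andP[/andP[/eqP[]]].
have /LP[fk tf] : f \in L by rewrite EL inE eqxx.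
have /LP[gk tg] : g \in L by rewrite EL !inE eqxx orbT.
have n1 : (n%:R : F) != 0 by apply: contraNneq a0 => n1; rewrite -tf n1 mul0r.
have : ptrace f = ptrace g by apply: (mulfI n1); rewrite tf tg.
rewrite (ptrace_monics fk) (ptrace_monics gk) => /oppr_inj fg0.
have [mf sf] := monicsP _ _ fk; have [mg sg] := monicsP _ _ gk.
apply/polyP => -[//|[|i]].
  by move: mf mg; rewrite !monicE /lead_coef sf sg /= => /eqP-> /eqP->.
by rewrite !nth_default ?sf ?sg.
Qed.

Lemma power_count_diag_gt0 n a b : (0 < power_count n n a b)%N -> (0 < n)%N ->
  exists x, n%:R * x = a /\ x ^+ n = b.
Proof.
move=> + n0 => /leq_trans/(_ (power_count_leq_monics _ _ n0 (mul1n n))).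
rewrite mul1n -has_count => /hasP[p pk /andP[/eqP tp /eqP np]].
have [mp sp] := monicsP _ _ pk; exists (ptrace p); rewrite -ptraceX // tp; split=> //.
by rewrite -np pnormX // (ptrace_monics pk) (pnorm_monics pk) expr1 mulN1r.
Qed.

(** An exponent [2 <= j < n] dividing [n] belongs to primes of the single degree [m + 2 = n / j], at
    most [n / 2]; the linear primes, [j = n], are kept apart. *)
Lemma power_counts_bound n a b : (2 <= n)%N -> a != 0 ->
  (\sum_(2 <= j < n.+1) power_count n j a b <=
   n * (\sum_(0 <= m < n./2.-1) #|F| ^ m) + power_count n n a b)%N.
Proof.
move=> n2 a0; rewrite big_nat_recr //= leq_add2r.
apply: (@leq_trans (\sum_(2 <= j < n)
    \sum_(0 <= m < n./2.-1 | (m.+2 * j == n)%N) n * #|F| ^ m)).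
  rewrite big_nat [X in (_ <= X)%N]big_nat; apply: leq_sum => j /andP[j2 jn].
  have [/dvdnP[m nE]|/power_count_ndvd->//] := boolP (j %| n)%N.
  have mE : m = m.-2.+2 by case: m nE => [|[|m]]; lia.
  have mjn : (m.-2.+2 * j = n)%N by rewrite -mE -nE.
  apply: leq_trans (power_count_leq b a0 (ltnW j2) mjn) _.
  rewrite (big_rem m.-2) /=; last first.
    rewrite mem_index_iota leq0n /=.
    have : (m <= n./2)%N by rewrite geq_half_double nE -muln2 leq_mul2l j2 orbT.
    lia.
  by rewrite mjn eqxx leq_addr.
under eq_bigr do rewrite big_mkcond.
rewrite exchange_big big_distrr /=; apply: leq_sum => m _.
rewrite -big_mkcond.
rewrite (eq_bigl (fun j => ((m.+2 %| n) && (j == n %/ m.+2))%N)); last first.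
  move=> j; apply/eqP/andP => [<-|[/dvdnP[k ->] /eqP->]].
    by rewrite dvdn_mulr // mulKn.
  by rewrite mulnK // mulnC.
by rewrite big_nat1_cond_eq; case: ifP.
Qed.

End PrimePowerCounts.

(** * Irreducible cubics with a degenerate trace and norm *)

Section DegenerateCubics.

Variables (F : finFieldType) (x : F).
Hypothesis x0 : x != 0.

Definition cubic (c : F) : {poly F} := ('X - x%:P) ^+ 3 + c *: 'X.

(** The one value of [c] for which a nonzero [t] is a root of [cubic c]. *)
Definition cubic_param (t : F) : F := - ((t - x) ^+ 3 / t).

Lemma cubic_monics c : cubic c \in monics F 3.
Proof.
apply: monics_addl; last by rewrite (leq_trans (size_scale_leq _ _)) ?size_polyX.
by apply: (@monicsX _ 1); apply/monicsP; rewrite monicXsubC size_XsubC.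
Qed.

Lemma cubic_coef2 c : (cubic c)`_2 = - (3%:R * x).
Proof.
have h : 'X - x%:P \in monics F 1 by apply/monicsP; rewrite monicXsubC size_XsubC.
have /ptrace_monics := monicsX 3 h; rewrite ptraceX ?monicXsubC //.
rewrite (ptrace_monics h) coefB coefX coefC /= sub0r opprK => /(congr1 -%R).
by rewrite opprK coefD coefZ coefX mulr0 addr0 => <-.
Qed.

Lemma cubic_coef0 c : (cubic c)`_0 = - x ^+ 3.
Proof. by rewrite -horner_coef0 !hornerE; ring. Qed.

Lemma cubic_irreducible_of_param c : c != 0 ->
  (forall t, t != 0 -> t != x -> cubic_param t != c) -> irreducible_poly (cubic c).
Proof.
move=> c0 hc; have [mc sc] := monicsP _ _ (cubic_monics c).
apply: cubic_irreducible; first by rewrite sc.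
move=> t; apply/rootP; rewrite !hornerE => e.
have t0 : t != 0.
  apply: contraNneq x0 => t0; move: e; rewrite t0 mulr0 addr0 sub0r => /eqP.
  by rewrite expf_eq0 oppr_eq0.
have tx : t != x.
  apply: contraNneq c0 => tx; move: e; rewrite tx subrr expr0n /= add0r => /eqP.
  by rewrite mulf_eq0 (negPf x0) orbF.
have /eqP[] := hc t t0 tx; rewrite /cubic_param.
by move/eqP: e; rewrite addr_eq0 => /eqP->; rewrite mulNr opprK mulfK.
Qed.

(** Each [c] outside [0] and the image of [D] gives a different irreducible cubic. As [D] only has
    to represent the values of [cubic_param], a collision between two parameters allows a smaller
    [D]. *)
Lemma cubic_count_lower (D : {set F}) :
  (forall t, t != 0 -> t != x -> exists2 t', t' \in D & cubic_param t = cubic_param t') ->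
  (#|F| <= num_irr_trace_norm 3 (3%:R * x)%R (x ^+ 3)%R + #|D|.+1)%N.
Proof.
move=> hD; pose T := ~: (0 |: cubic_param @: D).
have sT : (#|F| <= #|T| + #|D|.+1)%N.
  rewrite -(cardsC (0 |: cubic_param @: D)) addnC leq_add2l.
  rewrite (leq_trans (leq_card_setU _ _)) // cards1 add1n ltnS.
  exact: leq_imset_card.
apply: (leq_trans sT); rewrite leq_add2r.
pose h c := npolyp 4 (cubic c).
have hE c : (h c : {poly F}) = cubic c.
  by rewrite npolypK //; have [_ ->] := monicsP _ _ (cubic_monics c).
have hinj : injective h.
  move=> c c' /(congr1 (fun p : {poly_4 F} => (p : {poly F})`_1)).
  by rewrite !hE !coefD !coefZ !coefX !mulr1 => /addrI.
rewrite -(card_imset _ hinj) subset_leq_card //; apply/subsetP => _ /imsetP[c + ->].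
rewrite !inE negb_or => /andP[c0 cD].
have [mc sc] := monicsP _ _ (cubic_monics c).
rewrite hE sc mc cubic_coef2 cubic_coef0 eqxx /=.
have -> : (-1) ^+ 3 * x ^+ 3 = - x ^+ 3 by ring.
rewrite !eqxx /=; apply/asboolP; apply: cubic_irreducible_of_param => // t t0 tx.
have [t' tD ->] := hD t t0 tx.
by apply: contraNneq cD => <-; apply: imset_f.
Qed.

Lemma cubic_count_ge1 : (0 < num_irr_trace_norm 3 (3%:R * x)%R (x ^+ 3)%R)%N.
Proof.
have := @cubic_count_lower (~: [set 0; x]).
have : #|~: [set 0; x]| = (#|F| - 2)%N by rewrite cardsCs setCK cards2 eq_sym x0.
move=> -> /(_ _); have := finNzRing_gt1 F.
set N := num_irr_trace_norm _ _ _ => F1 h.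
have : (#|F| <= N + (#|F| - 2).+1)%N.
  by apply: h => t t0 tx; exists t; rewrite // !inE negb_or t0.
by clear h; move: F1; move: #|F| => k; clearbody N; lia.
Qed.

Lemma cubic_count_ge2 : (5 < #|F|)%N ->
  (1 < num_irr_trace_norm 3 (3%:R * x)%R (x ^+ 3)%R)%N.
Proof.
move=> F5.
(* A quintic cannot vanish on more than five elements. Its factors keep the denominators of [t1] and
   [t2] nonzero and make [t1], [t2] and [x] distinct. *)
have [s] : exists s : F, ~~ root ('X * ('X + 1%:P) * ('X ^+ 3 - 1%:P)) s.
  apply/existsP; rewrite -negb_forall; apply/negP => /forallP hr.
  have hm : 'X * ('X + 1%:P) * ('X ^+ 3 - 1%:P) \in monics F (1 + 1 + 3).
    apply: monicsM; first apply: monicsM; apply/monicsP.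
    - by rewrite monicX size_polyX.
    - by rewrite monicXaddC size_XaddC.
    - by rewrite monicXnsubC // size_XnsubC.
  have [mp sp] := monicsP _ _ hm.
  have rs : all (root ('X * ('X + 1%:P) * ('X ^+ 3 - 1%:P))) (enum F).
    by apply/allP => s _; apply: hr.
  have := max_poly_roots (monic_neq0 mp) rs (enum_uniq F).
  by rewrite -cardE sp ltnNge F5.
rewrite rootE !hornerE !mulf_eq0 !negb_or => /andP[/andP[s0 s1] s3].
(* The solution of [t1 / t2 = s ^ 3] and [(t1 - x) / (t2 - x) = s], which gives both the same
   [cubic_param]. *)
pose t1 := - x * s ^+ 2 / (s + 1); pose t2 := - x / (s * (s + 1)).
have q0 : s ^+ 2 + s + 1 != 0.
  apply: contraNneq s3 => e; apply/eqP.
  have -> : s ^+ 3 - 1 = (s ^+ 2 + s + 1) * (s - 1) by ring.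
  by rewrite e mul0r.
have e12 : cubic_param t1 = cubic_param t2.
  by rewrite /cubic_param /t1 /t2; field; rewrite s1 s0 oppr_eq0 x0.
have t10 : t1 != 0 by rewrite !mulf_neq0 ?oppr_eq0 ?expf_neq0 ?invr_eq0.
have t20 : t2 != 0 by rewrite !mulf_neq0 ?oppr_eq0 ?expf_neq0 ?invr_eq0 ?mulf_neq0.
have t1x : t1 != x.
  rewrite -subr_eq0 (_ : t1 - x = - x * (s ^+ 2 + s + 1) / (s + 1)); last first.
    by rewrite /t1; field.
  by rewrite !mulf_neq0 ?oppr_eq0 ?invr_eq0.
have t2x : t2 != x.
  rewrite -subr_eq0 (_ : t2 - x = - x * (s ^+ 2 + s + 1) / (s * (s + 1))); last first.
    by rewrite /t2; field; rewrite s1 s0.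
  by rewrite !mulf_neq0 ?oppr_eq0 ?invr_eq0 ?mulf_neq0.
have t12 : t1 != t2.
  rewrite -subr_eq0 (_ : t1 - t2 = - x * (s ^+ 3 - 1) / (s * (s + 1))); last first.
    by rewrite /t1 /t2; field; rewrite s1 s0.
  by rewrite !mulf_neq0 ?oppr_eq0 ?invr_eq0 ?mulf_neq0.
have := @cubic_count_lower (~: [set 0; x; t1]).
have : #|~: [set 0; x; t1]| = (#|F| - 3)%N.
  by rewrite cardsCs setCK setUC cardsU1 cards2 !inE negb_or t10 t1x eq_sym x0.
move=> -> h.
set N := num_irr_trace_norm _ _ _ in h *.
have : (#|F| <= N + (#|F| - 3).+1)%N.
  apply: h => t t0 tx; have [->|tt1] := eqVneq t t1.
    by exists t2; rewrite // !inE !negb_or t20 t2x eq_sym.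
  by exists t; rewrite // !inE !negb_or t0 tx.
by clear h; move: F5; move: #|F| => k; clearbody N; lia.
Qed.

End DegenerateCubics.

(** * The bound *)

Lemma powR_half (R : realType) (q : R) k : 0 <= q -> q `^ (k%:R / 2) = Num.sqrt q ^+ k.
Proof. by move=> q0; rewrite mulrC powRrM powR12_sqrt // powR_mulrn ?sqrtr_ge0. Qed.

(* The left-hand side is the Gauss sum bound divided by [q * (q - 1)]; the
   theorem's own bound is weaker by [2 / q]. *)
Lemma gauss_bound_le (R : realFieldType) (q s w d : R) : 1 < q -> s ^+ 2 = q ->
  (1 + w * s ^+ 2 * (d - 1 + (q - 1 - d) * s)) / (q * (q - 1)) <=
  (1 + (q - 2) * (w * s) - w * (s - 1) * (d - 1)) / (q - 1) + 1 / q.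
Proof.
move=> q1 sq; have q0 : 0 < q by lra.
have q10 : 0 < q - 1 by lra.
rewrite ler_pdivrMr ?mulr_gt0 // sq.
have -> : ((1 + (q - 2) * (w * s) - w * (s - 1) * (d - 1)) / (q - 1) + 1 / q) *
  (q * (q - 1)) =
  (1 + (q - 2) * (w * s) - w * (s - 1) * (d - 1)) * q + (q - 1).
  by field; rewrite !gt_eqF.
rewrite -subr_ge0.
have -> : (1 + (q - 2) * (w * s) - w * (s - 1) * (d - 1)) * q + (q - 1) -
  (1 + w * q * (d - 1 + (q - 1 - d) * s)) = 2 * (q - 1) by ring.
lra.
Qed.

Lemma geometric_sum_le (R : realFieldType) (q : nat) (s : R) n :
  (1 < q)%N -> 1 <= s -> s ^+ 2 = q%:R -> (2 <= n)%N ->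
  (\sum_(0 <= m < n./2.-1) q ^ m)%N%:R <= (s ^+ n - 1) / (q%:R * (q%:R - 1)).
Proof.
move=> q1 s1 sq n2.
have q1R : 1 < q%:R :> R by rewrite ltr1n.
have k0 : (0 < n./2)%N by rewrite half_gt0.
rewrite ler_pdivlMr; last by apply: mulr_gt0; lra.
have -> : (\sum_(0 <= m < n./2.-1) q ^ m)%N%:R * (q%:R * (q%:R - 1)) =
    q%:R ^+ n./2 - q%:R :> R.
  rewrite -[in RHS](prednK k0) exprS natr_sum big_mkord.
  under eq_bigr do rewrite natrX.
  set G := \sum_(i < _) _.
  transitivity (q%:R * ((q%:R - 1) * G)); first by ring.
  by rewrite -subrX1; ring.
have : q%:R ^+ n./2 <= s ^+ n.
  by rewrite -sq -exprM mul2n ler_weXn2l // -geq_half_double.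
lra.
Qed.

Theorem theorem5p2 (R : realType) (F : finFieldType) (n : nat) (a b : F)
    (hn : (2 <= n)%N) (ha : a != 0) (hb : b != 0) :
  let q : R := #|F|%:R in
  let d : R := (gcdn n (#|F| - 1)%N)%:R in
  `| (num_irr_trace_norm n a b)%:R - (q ^+ n - 1) / (n%:R * q * (q - 1)) |
  <= 1 / n%:R *
       ((1 + (q - 2) * q `^ ((n%:R - 1) / 2)
           - q `^ ((n%:R - 2) / 2) * (q `^ (1 / 2) - 1) * (d - 1)) / (q - 1)
        + 1 / q)
     + (q `^ (n%:R / 2) - 1) / (q * (q - 1))
     + n%:R / 2 * q `^ ((n%:R - 4) / 4).
Proof.
cbv zeta; set q : R := #|F|%:R; set d : R := (gcdn n _)%:R.
set P := num_irr_trace_norm n a b; set t := q `^ ((n%:R - 4) / 4).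
have F1 : (1 < #|F|)%N := finNzRing_gt1 F.
have q1 : 2 <= q by rewrite ler_nat.
have q0 : 0 <= q by lra.
set s := Num.sqrt q.
have sq : s ^+ 2 = q by rewrite sqr_sqrtr.
have s1 : 1 <= s by rewrite -sqrtr1 ler_wsqrtr //; lra.
have t0 : 0 <= t by rewrite powR_ge0.
have -> : (n%:R - 1) / 2 = (n.-1)%:R / 2 :> R by rewrite -subn1 natrB // ltnW.
have -> : (n%:R - 2) / 2 = (n.-2)%:R / 2 :> R by rewrite -subn2 natrB.
rewrite (_ : 1 / 2 = 1%:R / 2) // !powR_half // expr1 -/s.
set w := s ^+ n.-2.
have w0 : 0 <= w by rewrite exprn_ge0 //; lra.
have ws : s ^+ n.-1 = w * s by rewrite /w -exprSr; congr (_ ^+ _); lia.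
have wss : s ^+ n = w * s ^+ 2 by rewrite /w -exprD; congr (_ ^+ _); lia.
rewrite ws; set B := (_ / (q - 1) + 1 / q); set C := _ / (q * (q - 1)).
have n0 : 0 < n%:R :> R by rewrite ltr0n ltnW.
have nn0 : n%:R != 0 :> R by rewrite gt_eqF.
have qn0 : q != 0 by rewrite gt_eqF //; lra.
have q1n0 : q - 1 != 0 by rewrite gt_eqF //; lra.
pose M : R := (q ^+ n - 1) / (q * (q - 1)).
(* After multiplication by [n], [B] pays for the Gauss sums, [n C] for powers of primes of degree at
   least 2, and for [n >= 4] the last term pays for a linear prime. *)
suff main : `|n%:R * P%:R - M| <= B + n%:R * C + n%:R * (n%:R / 2 * t).
  rewrite -(ler_pM2l n0).
  have -> : n%:R * `|P%:R - (q ^+ n - 1) / (n%:R * q * (q - 1))| = `|n%:R * P%:R - M|.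
    rewrite -{1}(gtr0_norm n0) -normrM mulrBr; congr `|_ - _|; rewrite /M; field.
    by rewrite ?nn0 ?qn0 ?q1n0.
  apply: (le_trans main); rewrite le_eqVlt; apply/orP; left; apply/eqP; field.
  by rewrite ?nn0 ?qn0 ?q1n0.
have W0 := weighted_count_bound_real R (ltnW hn) ha hb.
rewrite -/q -/s in W0.
set W := weighted_count n a b in W0.
have d1 : (0 < gcdn n #|F|.-1)%N by rewrite gcdn_gt0 ltnW.
have dq : (gcdn n #|F|.-1 <= #|F|.-1)%N by rewrite dvdn_leq ?dvdn_gcdr ?card_pred_gt0.
have WB : `|W%:R - M| <= B.
  have qq0 : 0 < q * (q - 1) by rewrite mulr_gt0 //; lra.
  have q11 : 1 < q by lra.
  apply: le_trans (gauss_bound_le w d q11 sq).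
  rewrite ler_pdivlMr // mulrC -{1}(gtr0_norm qq0) -normrM.
  have -> : q * (q - 1) * (W%:R - M) = q * (q - 1) * W%:R - (q ^+ n - 1).
    by rewrite /M; field; rewrite ?qn0 ?q1n0.
  apply: (le_trans W0); rewrite wss -subn1 natrB // natrB // /d subn1.
  by rewrite -[#|F|.-1]subn1 natrB ?(ltnW F1).
have WS : W%:R = n%:R * P%:R + (\sum_(2 <= j < n.+1) power_count n j a b)%N%:R :> R.
  by rewrite /W weighted_count_split ?(ltnW hn) // natrD natrM.
set S := (\sum_(2 <= j < n.+1) power_count n j a b)%N in WS.
have S0 : 0 <= S%:R :> R by rewrite ler0n.
have C0 : 0 <= C.
  rewrite divr_ge0 ?mulr_ge0 //; last lra.
  by rewrite subr_ge0 exprn_ege1.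
have nC0 : 0 <= n%:R * C by rewrite mulr_ge0 // ltW.
have nt0 : 0 <= n%:R * (n%:R / 2 * t) by rewrite !mulr_ge0 // ?invr_ge0 // ltW.
have SC : S%:R <= n%:R * C + (power_count n n a b)%:R :> R.
  have h := power_counts_bound b hn ha.
  have h2 := geometric_sum_le F1 s1 sq hn.
  rewrite -(ler_nat R) natrD natrM in h.
  by apply: (le_trans h); rewrite lerD2r ler_wpM2l // ltW.
have p1 := power_count_diag_le1 b (ltnW hn) ha.
move: WB; rewrite !ler_norml => /andP[WB1 WB2].
(* Since [n P = W - S] with [S >= 0], proper powers only matter for the lower bound. *)
have up : n%:R * P%:R - M <= B + n%:R * C + n%:R * (n%:R / 2 * t) by lra.
rewrite up andbT.
have [n4|n4] := leqP 4 n.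
  have p1R : (power_count n n a b)%:R <= 1 :> R by rewrite -(ler_nat R) in p1.
  (* The exponent [(n - 4) / 4] is nonnegative exactly from [n = 4] on. *)
  have t1 : 1 <= t.
    have q11 : 1 <= q by lra.
    rewrite /t -[X in X <= _](powRr0 q) ler_powR // divr_ge0 // subr_ge0.
    by rewrite ler_nat.
  have nn : 4 <= n%:R :> R by rewrite ler_nat.
  have : 1 <= n%:R * (n%:R / 2 * t) by nra.
  lra.
case: (posnP (power_count n n a b)) => [pc0|pc1].
  by rewrite pc0 in SC; lra.
have /orP[/eqP n2|/eqP n3] : (n == 2)%N || (n == 3)%N.
  by move: hn n4; clear; case: n => [|[|[|[|]]]].
  have P0 : 0 <= n%:R * P%:R :> R by rewrite mulr_ge0.
  suff : M <= B by lra.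
  have -> : M = 1 + 1 / q by rewrite /M n2; field; rewrite ?qn0 ?q1n0.
  rewrite /B lerD2r ler_pdivlMr; last lra.
  have -> : w = 1 by rewrite /w n2.
  have /orP[/eqP dE|/eqP dE] : (gcdn n (#|F| - 1) == 1)%N || (gcdn n (#|F| - 1) == 2)%N.
    by rewrite n2; have := dvdn_gcdl 2 (#|F| - 1); rewrite dvdn_divisors // !inE.
    by rewrite /d dE; nra.
  (* For [d = 2], [M <= B] amounts to [(q - 3) (s - 1) >= 0], and [q] is odd. *)
  have q3 : 3 <= q.
    rewrite ler_nat; have := dvdn_gcdr n (#|F| - 1); rewrite dE.
    by move: F1; clear; case: #|F| => [|[|[|]]].
  by rewrite /d dE; nra.
have [x [xa xb]] := power_count_diag_gt0 pc1 (ltnW hn).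
rewrite n3 in xa xb.
have x0 : x != 0 by apply: contraNneq ha => x0; rewrite -xa x0 mulr0.
have P1 : (1 <= P)%N by rewrite /P n3 -xa -xb cubic_count_ge1.
have ME : M = q + 1 + 1 / q by rewrite /M n3; field; rewrite ?qn0 ?q1n0.
have wE : w = s by rewrite /w n3 expr1.
have P1R : 1 <= P%:R :> R by rewrite ler1n.
have BE : B = q - 1 - (s * (s - 1) * (d - 1)) / (q - 1) + 1 / q.
  by rewrite /B wE -expr2 sq; field; rewrite ?qn0 ?q1n0.
rewrite n3 in nC0 nt0 *.
(* Here [M - B = 2 + s (s - 1) (d - 1) / (q - 1)] has to be covered. For [d = 1] it is [2], and
   [3 P >= 3]; for [d = 3] it is at most [4], and [P >= 2] if [q > 5]. *)
have /orP[/eqP dE|/eqP dE] : (gcdn n (#|F| - 1) == 1)%N || (gcdn n (#|F| - 1) == 3)%N.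
  by rewrite n3; have := dvdn_gcdl 3 (#|F| - 1); rewrite dvdn_divisors // !inE.
  by move: BE; rewrite /d dE subrr mulr0 mul0r ME => ->; lra.
have r1 : s * (s - 1) * (3 - 1) / (q - 1) <= 2.
  rewrite ler_pdivrMr; last lra.
  nra.
have [q5|q5] := ltnP 5 #|F|.
  have P2 : (2 <= P)%N by rewrite /P n3 -xa -xb cubic_count_ge2.
  have P2R : 2 <= P%:R :> R by rewrite ler_nat.
  by move: BE; rewrite /d dE ME => ->; lra.
(* The only case left with 3 dividing [q - 1]: [M - B = 10 / 3] exceeds [3] by [1 / 3], which
   [3 C = 7 / 4] covers. *)
have F4 : #|F| = 4%N.
  have := dvdn_gcdr n (#|F| - 1); rewrite dE.
  by move: F1 q5; clear; case: #|F| => [|[|[|[|[|[|]]]]]].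
have q4 : q = 4 by rewrite /q F4.
have s2 : s = 2.
  by apply/eqP; rewrite -(eqrXn2 (n := 2)) ?sq ?q4 //; [apply/eqP; ring | lra].
move: BE; rewrite /d dE ME q4 s2 => ->.
have -> : 2 * (2 - 1) * (3 - 1) / (4 - 1) = 4 / 3 :> R by field.
have : C = 7 / 12 by rewrite /C n3 q4 s2; field.
lra.
Qed.
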